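(* Let $K$ be a simplicial complex on $[m]$ and $K_i$ simplicial complexes on $[n_i]$ for $i\in[m]$, and let $n\ge1$. If $K$ has a non-trivial $Sq^n$, then the same is true for the substitution complex $K\langle K_1,\ldots,K_m\rangle$.
   Context: $H^*(-)$ denotes cohomology with $\mathbb F_2$ coefficients. A simplicial complex $L$ ''has a non-trivial $Sq^n$'' if the Steenrod square $Sq^n\colon H^*(L)\to H^{*+n}(L)$ is non-zero (cohomology of the geometric realization). A simplicial complex on $[m]=\{1,\dots,m\}$ contains $\emptyset$ and has vertices labelled by $[m]$. For $K$ on $[m]$ and $K_i$ on $[n_i]$, the substitution complex $K\langle K_1,\ldots,K_m\rangle$ is the polyhedral join $(K_i,\emptyset)^{*K}$, i.e. the simplicial complex on vertices $v_{i,j}$ ($i\in[m]$, $j\in[n_i]$) whose simplices are exactly the joins (disjoint unions) $\tau_{i_1}*\cdots*\tau_{i_k}$ with $\{i_1,\dots,i_k\}\in K$ and $\tau_{i_j}\in K_{i_j}$, where the vertices of $K_i$ are identified with $v_{i,1},\dots,v_{i,n_i}$. *)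

(* Defs.v *)
From HB Require Import structures.
From mathcomp Require Import all_boot all_order all_algebra ring.

Set Implicit Arguments.
Unset Strict Implicit.
Unset Printing Implicit Defensive.

Import Order.TTheory GRing.Theory Num.Theory.
Local Open Scope ring_scope.

(* Ghost vertices are allowed: [set v] need not be a face.                    *)
Record scomplex (V : finType) := SComplex {
  face :> {set V} -> Prop;
  face0 : face set0;
  faceS : forall S T : {set V}, S \subset T -> face T -> face S
}.

Definition full (V : finType) : scomplex V :=
  @SComplex V (fun=> True) I (fun _ _ _ _ => I).

Definition simplicial (V W : finType) (K : scomplex V) (L : scomplex W)
  (f : V -> W) := forall S : {set V}, K S -> L (f @: S).

Section Substitution.
Variables (V : finType) (W : V -> finType).
Variables (K : scomplex V) (L : forall i, scomplex (W i)).

(* The vertex v_(i,j) is Tagged W j, with j : W i.                             *)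
Definition subst_face : {set {i : V & W i}} -> Prop := fun T =>
  exists (S : {set V}) (tau : forall i, {set W i}),
    [/\ K S, forall i, i \in S -> L i (tau i) &
        T = (\bigcup_(i in S) [set Tagged W j | j in tau i])].

Lemma subst_face0 : subst_face set0.
Proof.
exists set0, (fun=> set0); split; first exact: face0.
- by move=> i; rewrite inE.
- by rewrite big_set0.
Qed.

Lemma subst_faceS (T T' : {set {i : V & W i}}) :
  T \subset T' -> subst_face T' -> subst_face T.
Proof.
move=> sTT' [S [tau [KS Ltau defT']]].
exists S, (fun i => [set j in tau i | Tagged W j \in T]); split=> //.
  move=> i iS; apply: faceS (Ltau i iS).
  by apply/fintype.subsetP=> j; rewrite inE => /andP[].
apply/setP=> -[i j]; apply/idP/bigcupP => [Tij|].
  have: Tagged W j \in T' by move/fintype.subsetP: sTT'; apply.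
  rewrite defT' => /bigcupP[i' i'S /imsetP[j' j'tau /eqP]].
  rewrite -tag_eqE /tag_eq /= => /andP[/eqP eqi]; subst i'.
  rewrite tagged_asE => /eqP eqj; subst j'.
  by exists i => //; apply/imsetP; exists j => //; rewrite inE j'tau.
move=> [i' i'S /imsetP[j']]; rewrite inE => /andP[_ Tj'] ->; exact: Tj'.
Qed.

Definition substitution : scomplex {i : V & W i} :=
  SComplex subst_face0 subst_faceS.

End Substitution.

Section Words.
Variable T : Type.
Implicit Types (X Y : seq T -> 'F_2) (s : seq T) (v : T).

Lemma addF2 (a : 'F_2) : a + a = 0.
Proof. by apply: addrr_pchar2; exact: (@pchar_Fp 2). Qed.

Fixpoint wdel X s : 'F_2 :=
  if s is v :: s' then X s' + wdel (fun t => X (v :: t)) s' else 0.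

(* A recursive form of the sum over cuts in the cup-i products: the letters of *)
(* s go to X or to Y (b tells which), except that k of them go to both, and    *)
(* the side changes at each of these.                                          *)
Fixpoint wcup k b X Y s : 'F_2 :=
  if s is v :: s' then
    (if b then wcup k b X (fun t => Y (v :: t)) s'
     else wcup k b (fun t => X (v :: t)) Y s') +
    (if k is k'.+1 then
       wcup k' (~~ b) (fun t => X (v :: t)) (fun t => Y (v :: t)) s'
     else 0)
  else if k is 0%N then X [::] * Y [::] else 0.

Lemma eq_wdel X X' s : X =1 X' -> wdel X s = wdel X' s.
Proof.
elim: s X X' => //= v s IH X X' eX.
by rewrite eX (IH _ (fun t => X' (v :: t))).
Qed.

Lemma wdelD X X' s : wdel (fun t => X t + X' t) s = wdel X s + wdel X' s.
Proof.
elim: s X X' => [|v s IH] X X' /=; first by rewrite addr0.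
by rewrite IH addrACA.
Qed.

Lemma wdel0 s : wdel (fun=> 0) s = 0.
Proof. by elim: s => //= v s ->; rewrite addr0. Qed.

Lemma eq_wcup k b X X' Y Y' s :
  X =1 X' -> Y =1 Y' -> wcup k b X Y s = wcup k b X' Y' s.
Proof.
elim: s k b X X' Y Y' => [|v s IH] k b X X' Y Y' eX eY /=.
  by case: k => //; rewrite eX eY.
congr (_ + _); first by case: b; apply: IH => // t; rewrite ?eX ?eY.
by case: k => // k; apply: IH => t; rewrite ?eX ?eY.
Qed.

Lemma wcupDl k b X X' Y s :
  wcup k b (fun t => X t + X' t) Y s = wcup k b X Y s + wcup k b X' Y s.
Proof.
elim: s k b X X' Y => [|v s IH] k b X X' Y /=.
  by case: k => [|k]; rewrite ?mulrDl ?addr0.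
rewrite [RHS]addrACA; congr (_ + _); first by case: b; rewrite IH.
by case: k => [|k]; rewrite ?addr0 // IH.
Qed.

Lemma wcupC k b X Y s : wcup k b X Y s = wcup k (~~ b) Y X s.
Proof.
elim: s k b X Y => [|v s IH] k b X Y /=.
  by case: k => // ; rewrite mulrC.
by congr (_ + _); [case: b | case: k => // k]; rewrite IH.
Qed.

Lemma wcupDr k b X Y Y' s :
  wcup k b X (fun t => Y t + Y' t) s = wcup k b X Y s + wcup k b X Y' s.
Proof. by rewrite wcupC wcupDl -!(wcupC k b). Qed.

Lemma wdel_wcup k b X Y s :
  wdel (wcup k b X Y) s = wcup k b (wdel X) Y s + wcup k b X (wdel Y) s +
  (if k is k'.+1 then wcup k' b X Y s + wcup k' (~~ b) X Y s else 0).
Proof.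
elim: s k b X Y => [|v s IH] k b X Y.
  case: k => [|[|k]] /=; rewrite ?mul0r ?mulr0 ?addF2 ?addr0 //.
pose Xv t := X (v :: t); pose Yv t := Y (v :: t).
have DX k' b' Z : wcup k' b' (fun t => wdel X (v :: t)) Z s =
    wcup k' b' X Z s + wcup k' b' (wdel Xv) Z s by rewrite -wcupDl.
have DY k' b' Z : wcup k' b' Z (fun t => wdel Y (v :: t)) s =
    wcup k' b' Z Y s + wcup k' b' Z (wdel Yv) s by rewrite -wcupDr.
have two : 1 + 1 = 0 :> 'F_2 by apply: addF2.
rewrite [LHS]/= wdelD.
by case: b; case: k => [|[|k]] /=;
  rewrite ?wdel0 !IH ?DX ?DY ?addr0 /= /Xv /Yv; ring: two.
Qed.

Lemma wdel_wdel X s : wdel (wdel X) s = 0.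
Proof.
elim: s X => //= v s IH X.
by rewrite wdelD IH addr0 addF2.
Qed.

Lemma wdelE X s : wdel X s = \sum_(k < size s) X (take k s ++ drop k.+1 s).
Proof.
elim: s X => [|v s IH] X /=; first by rewrite big_ord0.
by rewrite big_ord_recl /= drop0; congr (_ + _); rewrite IH.
Qed.
End Words.

Lemma wcup_map (T T' : Type) (f : T' -> T) k b (X Y : seq T -> 'F_2) s :
  wcup k b X Y (map f s) = wcup k b (X \o map f) (Y \o map f) s.
Proof.
elim: s k b X Y => //= v s IH k b X Y; rewrite !IH.
by case: b; case: k => //= k; rewrite IH.
Qed.

Section Sets.
Variable N : nat.
Implicit Types S : {set 'I_N}.

(* The two sides of the cut of {0, .., N-1} at the points of S; the cut points *)
(* belong to both, and part false S is the side that contains 0.               *)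
Definition part (b : bool) S : {set 'I_N} :=
  [set v in 'I_N | (v \in S) || (odd #|[set u in S | u < v]%N| == b)].

Lemma wcupE k b0 (X Y : seq 'I_N -> 'F_2) s : sorted (fun u v : 'I_N => (u < v)%N) s ->
  wcup k b0 X Y s = \sum_(S : {set 'I_N} | (S \subset s) && (#|S| == k))
    X [seq v <- s | v \in part b0 S] * Y [seq v <- s | v \in part (~~ b0) S].
Proof.
elim: s k b0 X Y => [|v s IH] k b0 X Y /=.
  have nilE S : (S \subset ([::] : seq 'I_N)) = (S == set0).
    by rewrite -subset0; apply/subsetP/subsetP => sS u /sS; rewrite inE.
  move=> _; case: k => [|k]; last first.
    by rewrite big_pred0 // => S; rewrite nilE; case: eqP => // ->; rewrite cards0.
  by rewrite (big_pred1 set0) // => S; rewrite nilE cards_eq0 andbb.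
move=> vs; have ss := path_sorted vs.
have /allP lt_v : all (fun u : 'I_N => (v < u)%N) s.
  by apply: order_path_min vs => a b c; apply: ltn_trans.
rewrite (bigID (fun S => v \in S)) /= addrC; congr (_ + _).
- transitivity (\sum_(S : {set 'I_N} | (S \subset s) && (#|S| == k))
    X (if b0 then [seq v <- s | v \in part b0 S]
       else v :: [seq v <- s | v \in part b0 S]) *
    Y (if b0 then v :: [seq v <- s | v \in part (~~ b0) S]
       else [seq v <- s | v \in part (~~ b0) S])).
    by case: b0; rewrite IH.
  have svs S : v \notin S -> (S \subset v :: s) = (S \subset s).
    move=> vS; apply/subsetP/subsetP => sS u uS; last by rewrite inE sS ?orbT.
    by have := sS u uS; rewrite inE => /predU1P[eu|//]; rewrite -eu uS in vS.
  have vnots : v \notin s by apply/negP => /lt_v; rewrite ltnn.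
  apply: eq_big => [S|S /andP[sS kS]].
    case vS: (v \in S); last by rewrite svs ?vS ?andbT.
    rewrite andbF; apply/negbTE/negP => /andP[/subsetP/(_ _ vS)].
    by rewrite (negbTE vnots).
  have vS : v \notin S by apply: contra vnots; apply/subsetP.
  have e0 : #|[set u in S | (u < v)%N]| = 0%N.
    apply/eqP; rewrite cards_eq0; apply/eqP/setP => u; rewrite !inE.
    apply/negbTE/negP => /andP[/(subsetP sS)/lt_v vu uv].
    by have := ltn_trans vu uv; rewrite ltnn.
  rewrite /part !inE (negbTE vS) e0 /=.
  by case: b0.
- case: k => [|k].
    rewrite big1 // => S /andP[/andP[_]]; rewrite cards_eq0 => /eqP ->.
    by rewrite inE.
  have vnots : v \notin s by apply/negP => /lt_v; rewrite ltnn.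
  have notS S : S \subset s -> v \notin S.
    by move=> sS; apply: contra vnots; apply/subsetP.
  rewrite IH // [RHS](reindex_onto (fun S => v |: S) (fun S => S :\ v)) /=; last first.
    by move=> S /andP[_ vS]; rewrite setD1K.
  apply: eq_big => [S|S /andP[sS kS]].
    rewrite setU11 andbT.
    apply/idP/idP => [/andP[sS kS]|/andP[/andP[sS kS] /eqP eS]].
      have vS := notS _ sS.
      rewrite setU1K // eqxx andbT cardsU1 vS add1n eqSS kS andbT.
      apply/subsetP => u; rewrite !inE => /predU1P[->|/(subsetP sS) ->].
        by rewrite eqxx.
      by rewrite orbT.
    have vS : v \notin S by rewrite -eS !inE eqxx.
    rewrite cardsU1 vS add1n eqSS in kS; rewrite kS andbT.
    apply/subsetP => u uS.
    have /(subsetP sS) : u \in v |: S by rewrite !inE uS orbT.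
    by rewrite inE => /predU1P[eu|//]; rewrite -eu uS in vS.
  have vS := notS _ sS.
  have fE b : [seq u <- s | u \in part (~~ b) S] = [seq u <- s | u \in part b (v |: S)].
    apply: eq_in_filter => u us; rewrite !inE.
    have vu := lt_v u us; rewrite (negbTE (_ : u != v)) /=; last first.
      by apply: contraTneq vu => ->; rewrite ltnn.
    have -> : [set w in v |: S | (w < u)%N] = v |: [set w in S | (w < u)%N].
      by apply/setP => w; rewrite !inE; case: eqP => // ->; rewrite vu.
    rewrite cardsU1 !inE (negbTE vS) /=.
    by case: odd; case: b.
  have vP b : v \in part b (v |: S) by rewrite !inE eqxx.
  by rewrite !vP -!fE negbK.
Qed.

Lemma sorted_enum_ord : sorted (fun u v : 'I_N => (u < v)%N) (enum 'I_N).
Proof. by have := iota_ltn_sorted 0 N; rewrite -val_enum_ord sorted_map. Qed.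

Lemma wcup_enum k (X Y : seq 'I_N -> 'F_2) :
  wcup k false X Y (enum 'I_N) = \sum_(S : {set 'I_N} | #|S| == k)
    X (enum (part false S)) * Y (enum (part true S)).
Proof.
rewrite wcupE ?sorted_enum_ord //; apply: eq_big => [S|S _].
  by rewrite andb_idl // => _; apply/subsetP => u _; rewrite mem_enum.
by rewrite !enumT.
Qed.

End Sets.

Lemma enum_lift n (j : 'I_n.+1) :
  map (lift j) (enum 'I_n) = take j (enum 'I_n.+1) ++ drop j.+1 (enum 'I_n.+1).
Proof.
apply: (inj_map val_inj); rewrite -map_comp map_cat map_take map_drop.
rewrite val_enum_ord.
have -> : [seq (val \o lift j) i | i <- enum 'I_n] = map (bump j) (iota 0 n).
  by rewrite -val_enum_ord -map_comp.
have jn : (j <= n)%N by rewrite -ltnS.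
apply: (@eq_from_nth _ 0%N) => [|i].
  rewrite size_map size_cat size_take size_drop !size_iota ltnS.
  by rewrite jn; rewrite subSS subnKC.
rewrite size_map size_iota => lti; rewrite (nth_map 0%N) ?size_iota //.
rewrite nth_iota // nth_cat size_take size_iota ltnS jn /bump add0n.
case: ltnP => ij.
  by rewrite nth_take // nth_iota ?add0n //; apply: ltn_trans ij _.
by rewrite nth_drop nth_iota ?add0n addSn ?ltnS subnKC.
Qed.

From mathcomp Require Import all_classical all_reals all_analysis.
Import numFieldNormedType.Exports.
Local Open Scope classical_set_scope.
Local Open Scope quotient_scope.

Lemma continuous_prod (X : topologicalType) (I : Type)
    (T : I -> topologicalType) (f : X -> prod_topology T) :
  (forall i, continuous (fun x => f x i : T i)) -> continuous f.
Proof.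
move=> cf x; apply/(@cvg_sup _ I (fun i => Topological.class
  (initial_topology (fun g : (forall i, T i) => g i)))) => i.
exact: (@continuous_comp_initial _ _ _
  (fun g : (forall i, T i) => g i) f (cf i) x).
Qed.

Section Realization.
Variable R : realType.

(* V is finite, so the product topology induces the usual (weak) topology of   *)
(* the polyhedron |K|.                                                         *)
Definition realization (V : finType) (K : scomplex V) : set {ptws V -> R} :=
  [set x | [/\ forall v, 0 <= x v, \sum_v x v = 1 &
             K [set v | x v != 0]%SET]].

Definition push (V W : finType) (f : V -> W) (x : {ptws V -> R}) :
  {ptws W -> R} := fun w => \sum_(v | f v == w) x v.

Lemma push_realization (V W : finType) (K : scomplex V) (L : scomplex W)
    (f : V -> W) (x : {ptws V -> R}) : simplicial K L f ->
  realization K x -> realization L (push f x).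
Proof.
move=> Kf [x0 x1 Kx]; split.
- by move=> w; apply: sumr_ge0.
- by rewrite -x1 [RHS](partition_big f xpredT).
- apply: faceS (Kf _ Kx); apply/fintype.subsetP=> w; rewrite inE => fxw.
  apply/imsetP; apply: contrapT => nw; move/eqP: fxw; apply.
  apply: big1 => v /eqP fv; apply: contrapT => /eqP xv; apply: nw.
  by exists v => //; rewrite inE.
Qed.

Lemma push_continuous (V W : finType) (f : V -> W) : continuous (push f).
Proof.
apply: (@continuous_prod _ W (fun=> R)) => w; rewrite /push.
apply: (@continuous_big R^o) => [x|v _]; first exact: (@add_continuous R^o).
exact: (@proj_continuous V (fun=> R) v).
Qed.

Lemma push_comp (U V W : finType) (g : V -> W) (f : U -> V) (x : {ptws U -> R}) :
  push g (push f x) = push (g \o f) x.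
Proof.
apply/funext => w; rewrite /push [RHS](partition_big f (fun v => g v == w)) //.
apply: eq_bigr => v /eqP gv; apply: eq_bigl => u /=.
by case: eqP => [->|]; rewrite ?andbF // gv eqxx.
Qed.

Section Map.
Variables (V W : finType) (K : scomplex V) (L : scomplex W) (f : V -> W).
Hypothesis Kf : simplicial K L f.

Definition realization_map (x : realization K) : realization L :=
  SigSub (mem_set (push_realization Kf (set_mem (valP x)))).

Lemma realization_map_continuous : continuous realization_map.
Proof.
apply: (@continuous_comp_initial _ _ _ set_val realization_map) => x.
rewrite (_ : _ \o _ = push f \o set_val); last by rewrite !set_valE.
apply: continuous_comp; first exact: initial_continuous.
exact: push_continuous.
Qed.

HB.instance Definition _ :=
  isContinuous.Build _ _ realization_map realization_map_continuous.

End Map.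

Definition stdsimplex (p : nat) := realization (full 'I_p.+1).
Arguments stdsimplex p : clear implicits.

(* The affine map of standard simplices that is f on vertices.                 *)
Definition vmap (p q : nat) (f : 'I_p.+1 -> 'I_q.+1) :
  stdsimplex p -> stdsimplex q :=
  realization_map (K := full _) (L := full _) (f := f) (fun _ _ => I).

HB.instance Definition _ p q (f : 'I_p.+1 -> 'I_q.+1) :=
  Continuous.on (vmap f).

Lemma vmap_comp (p q r : nat) (g : 'I_q.+1 -> 'I_r.+1) (f : 'I_p.+1 -> 'I_q.+1) :
  vmap g \o vmap f = vmap (g \o f).
Proof. by apply/funext => x; apply: val_inj; rewrite /= push_comp. Qed.

End Realization.
Arguments realization R {V} K.
Arguments stdsimplex R p : clear implicits.
Arguments vmap R {p q} f.

(* Singular cohomology of X with coefficients in F_2, and its Steenrod squares *)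
(* defined by the cup-i products of singular cochains.                         *)
Section Cohomology.
Variables (R : realType) (X : topologicalType).

Definition singular (p : nat) := continuousType (stdsimplex R p) X.

Definition restr (p q : nat) (sigma : singular q) (f : 'I_p.+1 -> 'I_q.+1) :
  singular p := sigma \o vmap R f.

Lemma restr_comp (p q r : nat) (sigma : singular r)
    (g : 'I_q.+1 -> 'I_r.+1) (f : 'I_p.+1 -> 'I_q.+1) :
  restr (restr sigma g) f = restr sigma (g \o f).
Proof.
apply/continuousEP => x /=.
by rewrite -[vmap R g _]/((vmap R g \o vmap R f) x) vmap_comp.
Qed.

Lemma eq_restr (p q : nat) (sigma : singular q) (f g : 'I_p.+1 -> 'I_q.+1) :
  f =1 g -> restr sigma f = restr sigma g.
Proof. by move=> /funext ->. Qed.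

Definition cochain (p : nat) := singular p -> 'F_2.

HB.instance Definition _ p := GRing.Zmodule.on (cochain p).

Definition cobound (p : nat) (x : cochain p) : cochain p.+1 :=
  fun sigma => \sum_(j < p.+2) x (restr sigma (lift j)).

(* The value of x on the face of sigma spanned by the vertices s; cochains     *)
(* vanish on faces of the wrong dimension.                                     *)
Definition ev (p N : nat) (x : cochain p) (sigma : singular N)
  (s : seq 'I_N.+1) : 'F_2 :=
  if size s == p.+1 then x (restr sigma (fun j : 'I_p.+1 => nth ord0 s j)) else 0.

(* Steenrod's cup-(k-1) product: the vertices 0..N are cut at k of them, the   *)
(* cut points u_1 < .. < u_k belonging to both sides; x is evaluated on the    *)
(* pieces [0,u_1], [u_2,u_3], .. and y on [u_1,u_2], [u_3,u_4], .. For k = 1   *)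
(* this is the Alexander-Whitney product, and for k = 0 it is zero. The terms  *)
(* are zero unless N = p + q - (k - 1), so taking N as a parameter costs       *)
(* nothing and avoids casts.                                                   *)
Definition cupk (k N p q : nat) (x : cochain p) (y : cochain q) : cochain N :=
  fun sigma => \sum_(S : {set 'I_N.+1} | #|S| == k)
    ev x sigma (enum (part false S)) * ev y sigma (enum (part true S)).
Arguments cupk k N {p q} x y.

Definition cup (i N p q : nat) (x : cochain p) (y : cochain q) : cochain N :=
  cupk i.+1 N x y.
Arguments cup i N {p q} x y.

Lemma cochainDE p (x y : cochain p) sigma : (x + y) sigma = x sigma + y sigma.
Proof. by []. Qed.

Lemma coboundD p (x y : cochain p) : cobound (x + y) = cobound x + cobound y.
Proof. by apply/funext => s; exact: big_split. Qed.

Lemma cobound0 p : cobound (0 : cochain p) = 0.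
Proof. by apply/funext => s; exact: big1. Qed.

Lemma addcc p (x : cochain p) : x + x = 0.
Proof. by apply/funext => s; apply: addF2. Qed.

Lemma oppc p (x : cochain p) : - x = x.
Proof. by apply/eqP; rewrite eq_sym -subr_eq0 opprK addcc. Qed.

Lemma ev_enum p (x : cochain p) (sigma : singular p) :
  ev x sigma (enum 'I_p.+1) = x sigma.
Proof.
rewrite /ev size_enum_ord eqxx; congr x; apply/continuousEP => t /=.
congr (sigma _); apply: val_inj; apply/funext => j; rewrite /= /push.
rewrite (big_pred1 j) // => i; rewrite nth_ord_enum //.
Qed.

Lemma ev_restr p q N (x : cochain p) (sigma : singular N)
    (f : 'I_q.+1 -> 'I_N.+1) s :
  ev x (restr sigma f) s = ev x sigma (map f s).
Proof.
rewrite /ev size_map; case: eqP => // ss; rewrite restr_comp.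
by congr x; apply: eq_restr => j /=; rewrite (nth_map ord0) // ss.
Qed.

Lemma ev_cobound p N (x : cochain p) (sigma : singular N) s :
  ev (cobound x) sigma s = wdel (ev x sigma) s.
Proof.
have szd k : (k < size s)%N -> size (take k s ++ drop k.+1 s) = (size s).-1.
  move=> ks; rewrite size_cat size_take size_drop ks subnS -subn1.
  by rewrite addnBA ?subn_gt0 // subnKC ?subn1 // ltnW.
pose F k := ev x sigma (take k s ++ drop k.+1 s).
rewrite wdelE -(big_mkord xpredT F) big_mkord {1}/ev.
case: eqP => [ss|nss]; last first.
  rewrite big1 // => k _; rewrite /F /ev szd //; case: eqP => // e.
  by case: nss; rewrite -e prednK // (leq_ltn_trans _ (ltn_ord k)).
rewrite -[RHS](big_mkord xpredT F) ss big_mkord; apply: eq_bigr => k _.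
have ks : (k < size s)%N by rewrite ss.
rewrite /F /ev szd // ss eqxx restr_comp; congr x; apply: eq_restr => j /=.
rewrite nth_cat size_take ks /bump; case: (ltnP j k) => jk.
  by rewrite nth_take.
by rewrite nth_drop addSn subnKC.
Qed.

Lemma cupkE k N p q (x : cochain p) (y : cochain q) (sigma : singular N) :
  cupk k N x y sigma = wcup k false (ev x sigma) (ev y sigma) (enum 'I_N.+1).
Proof. by rewrite wcup_enum. Qed.

Lemma cobound_cupk k N p q (x : cochain p) (y : cochain q) :
  cobound (cupk k N x y) =
  cupk k N.+1 (cobound x) y + cupk k N.+1 x (cobound y) +
  (if k is k'.+1 then cupk k' N.+1 x y + cupk k' N.+1 y x else 0).
Proof.
apply/funext => sigma.
have -> : cobound (cupk k N x y) sigma =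
    wdel (wcup k false (ev x sigma) (ev y sigma)) (enum 'I_N.+2).
  rewrite wdelE size_enum_ord; apply: eq_bigr => j _.
  rewrite cupkE -enum_lift [RHS]wcup_map.
  by apply: eq_wcup => s; rewrite ev_restr.
rewrite wdel_wcup !cochainDE !cupkE.
congr (_ + _ + _).
- by apply: eq_wcup => s //; rewrite ev_cobound.
- by apply: eq_wcup => s //; rewrite ev_cobound.
- by case: k => // k; rewrite cochainDE !cupkE [in X in _ + X]wcupC.
Qed.

Lemma cobound_cobound p (x : cochain p) : cobound (cobound x) = 0.
Proof.
apply/funext => sigma.
by rewrite -ev_enum !ev_cobound (eq_wdel _ (ev_cobound _ _)) wdel_wdel.
Qed.

Lemma cupkDl k N p q (x x' : cochain p) (y : cochain q) :
  cupk k N (x + x') y = cupk k N x y + cupk k N x' y.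
Proof.
apply/funext => sigma; rewrite cochainDE !cupkE -wcupDl.
by apply: eq_wcup => // s; rewrite /ev; case: ifP => _; rewrite ?addr0.
Qed.

Lemma cupkDr k N p q (x : cochain p) (y y' : cochain q) :
  cupk k N x (y + y') = cupk k N x y + cupk k N x y'.
Proof.
apply/funext => sigma; rewrite cochainDE !cupkE -wcupDr.
by apply: eq_wcup => // s; rewrite /ev; case: ifP => _; rewrite ?addr0.
Qed.

Lemma cupk0l k N p q (y : cochain q) : cupk k N (0 : cochain p) y = 0.
Proof. by apply: (addrI (cupk k N (0 : cochain p) y)); rewrite -cupkDl !addr0. Qed.

Lemma cupk0r k N p q (x : cochain p) : cupk k N x (0 : cochain q) = 0.
Proof. by apply: (addrI (cupk k N x (0 : cochain q))); rewrite -cupkDr !addr0. Qed.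

Definition is_cocycle p : {pred cochain p} := [pred x | cobound x == 0].

Lemma cocycle_zmod_closed p : zmod_closed (@is_cocycle p).
Proof.
split=> [|x y]; rewrite !inE.
  by rewrite cobound0.
by move=> x0 y0; rewrite oppc coboundD x0 y0 addr0.
Qed.

HB.instance Definition _ p :=
  GRing.isZmodClosed.Build (cochain p) (@is_cocycle p) (@cocycle_zmod_closed p).

Record cocycle p := Cocycle {
  cocycle_val :> cochain p;
  _ : cocycle_val \in @is_cocycle p
}.
HB.instance Definition _ p := [isSub for @cocycle_val p].
HB.instance Definition _ p := [Choice of cocycle p by <:].
HB.instance Definition _ p := [SubChoice_isSubZmodule of cocycle p by <:].

Definition is_coboundary p : cochain p -> Prop :=
  match p with
  | 0%N => fun x => x = 0
  | p'.+1 => fun x => exists b : cochain p', x = cobound b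
  end.

Definition coboundary p : {pred cocycle p} :=
  [pred z : cocycle p | `[< is_coboundary (val z) >]].

Lemma coboundaryE p (z : cocycle p) :
  (z \in @coboundary p) <-> is_coboundary (val z).
Proof. by split=> [/asboolP|?]; last exact/asboolP. Qed.

Lemma coboundary_zmod_closed p : zmod_closed (@coboundary p).
Proof.
split=> [|x y]; rewrite !coboundaryE.
  by rewrite raddf0; case: p => //= p; exists 0; rewrite cobound0.
rewrite raddfB; case: p => [|p] /= in x y *.
  by move=> -> ->; rewrite subr0.
by move=> [b ->] [b' ->]; exists (b + b'); rewrite oppc coboundD.
Qed.

HB.instance Definition _ p :=
  GRing.isZmodClosed.Build (cocycle p) (@coboundary p)
    (@coboundary_zmod_closed p).

(* The quotient by a subgroup; ideal_quot only needs a zmodType.              *)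
Definition cohomology p := {ideal_quot (@coboundary p)}.
HB.instance Definition _ p := GRing.Zmodule.on (cohomology p).

Definition cclass p (z : cocycle p) : cohomology p :=
  \pi_({ideal_quot (@coboundary p)}) z.

Lemma cclassP p (z z' : cocycle p) :
  cclass z = cclass z' <-> is_coboundary (val z - val z').
Proof.
rewrite -raddfB -coboundaryE Quotient.idealrBE.
by split=> [/eqP|/eqP].
Qed.

(* Sq^n is x cup_(p-n) x in degree p, and zero when n > p.                    *)
Definition sq n p (x : cochain p) : cochain (p + n) :=
  if (n <= p)%N then cup (p - n) (p + n) x x else 0.
Arguments sq n {p} x.

Lemma sq_cocycle n p (z : cocycle p) : sq n z \in @is_cocycle (p + n).
Proof.
rewrite inE /sq; case: ifP => _; last first.
  by rewrite cobound0.
have z0 : cobound z = 0 by apply/eqP; exact: (valP z).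
by rewrite cobound_cupk z0 cupk0l cupk0r !add0r addcc.
Qed.

Lemma is_coboundary0 p : is_coboundary (0 : cochain p).
Proof. by case: p => //= p; exists 0; rewrite cobound0. Qed.

Lemma sq_cohomologous n p (x x' : cochain p) : cobound x = 0 ->
  is_coboundary (x' - x) -> is_coboundary (sq n x' - sq n x).
Proof.
case: p => [|p] in x x' * => x0 /=.
  by move=> /subr0_eq ->; rewrite subrr; apply: is_coboundary0.
move=> [b /eqP]; rewrite subr_eq => /eqP ->; rewrite /sq.
case: ifP => _; last by rewrite subrr; apply: (@is_coboundary0 (p.+1 + n)).
set i := (p.+1 - n)%N; set N := (p + n)%N; pose db := cobound b.
have db0 : cobound db = 0 by rewrite cobound_cobound.
exists (cupk i.+2 N x db + cupk i.+1 N b db + cupk i N b b).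
rewrite !coboundD !cobound_cupk x0 db0 !cupk0l !cupk0r -/db !add0r !addr0.
rewrite /cup !cupkDl !cupkDr -[(p.+1 + n)%N]/(N.+1) oppc.
set xd := cupk _ _ x db; set dx := cupk _ _ db x; set dd := cupk _ _ db db.
set xx := cupk _ _ x x; set bd := cupk _ _ b db; set bd' := cupk _ _ db b.
have -> : (if i is k'.+1 then cupk k' N.+1 b b + cupk k' N.+1 b b else 0) = 0.
  by case: (i) => // k'; rewrite addcc.
have two : 1 + 1 = 0 :> 'F_2 by apply: addF2.
by rewrite addr0; apply/funext => s; rewrite !cochainDE; ring: two.
Qed.

(* sq_cocycle makes the value a class, and Sq_cclass below states that it does *)
(* not depend on the representative repr c.                                    *)
Definition Sq n p (c : cohomology p) : cohomology (p + n) :=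
  cclass (Cocycle (sq_cocycle n (repr (c : {ideal_quot (@coboundary p)})))).

Lemma Sq_cclass n p (z : cocycle p) :
  Sq n (cclass z) = cclass (Cocycle (sq_cocycle n z)).
Proof.
rewrite /Sq; set z' := repr _.
have : cclass z' = cclass z by apply: reprK.
rewrite !cclassP => zz'.
by apply: sq_cohomologous zz'; apply/eqP; exact: (valP z).
Qed.

End Cohomology.

Arguments Sq {R X} n {p} c.
Arguments cclass {R X p} z.

Definition nontrivial_Sq (R : realType) (V : finType) (K : scomplex V) n :=
  exists p (c : cohomology R (realization R K) p), Sq n c != 0.

(* Main.v *)
Require Import Defs.
From mathcomp Require Import all_boot all_order all_algebra.
From mathcomp Require Import all_classical all_reals all_analysis.

(** Choosing a vertex in each [L i] embeds [K] in the substitution complex, and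
    the projection of [v_(i,j)] to [i] is a simplicial retraction of this
    embedding.  So [|K|] is a retract of the realization of the substitution
    complex, and naturality of [Sq^n] transfers its non-triviality. *)

Set Implicit Arguments.
Unset Strict Implicit.
Unset Printing Implicit Defensive.

Import GRing.Theory.
Local Open Scope ring_scope.

Arguments sq {R X} n {p} x.

Section Pullback.
Variables (R : realType) (X Y : topologicalType) (f : continuousType X Y).

Definition push_singular p (sigma : singular R X p) : singular R Y p :=
  f \o sigma.

Definition pullback p (x : cochain R Y p) : cochain R X p :=
  fun sigma => x (push_singular sigma).

Lemma push_singular_restr p q (sigma : singular R X q) (g : 'I_p.+1 -> 'I_q.+1) :
  push_singular (restr sigma g) = restr (push_singular sigma) g.
Proof. exact/continuousEP. Qed.

Lemma cobound_pullback p (x : cochain R Y p) :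
  cobound (pullback x) = pullback (cobound x).
Proof.
apply/funext => sigma; apply: eq_bigr => j _.
by rewrite /pullback push_singular_restr.
Qed.

Lemma ev_pullback p N (x : cochain R Y p) (sigma : singular R X N) s :
  ev (pullback x) sigma s = ev x (push_singular sigma) s.
Proof. by rewrite /ev /pullback push_singular_restr. Qed.

(** Each cup-i product is a sum of products of values on faces, and taking faces commutes with
    composing with [f]; so naturality holds already for cochains. *)
Lemma sq_pullback n p (x : cochain R Y p) :
  sq n (pullback x) = pullback (sq n x).
Proof.
rewrite /sq; case: ifP => // _; apply/funext => sigma.
by apply: eq_bigr => S _; rewrite !ev_pullback.
Qed.

Lemma is_coboundary_pullback p (x : cochain R Y p) :
  is_coboundary x -> is_coboundary (pullback x).
Proof.
case: p x => [|p] x /= => [-> //|[b ->]].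
by exists (pullback b); rewrite cobound_pullback.
Qed.

End Pullback.

Lemma cclass_eq0 (R : realType) (X : topologicalType) p (z : cocycle R X p) :
  cclass z = 0 <-> is_coboundary (val z).
Proof.
have -> : (0 : cohomology R X p) = cclass 0 by rewrite /cclass raddf0.
by rewrite cclassP raddf0 addr0.
Qed.

(** The witness is the class of [pullback g z], where [z] represents [c]: if its square were a
    coboundary, pulling back along [f] would make [sq n z] one too. *)
Lemma retract_Sq_neq0 (R : realType) (X Y : topologicalType)
    (f : continuousType X Y) (g : continuousType Y X) n p
    (c : cohomology R X p) :
  cancel f g -> Sq n c != 0 -> exists c' : cohomology R Y p, Sq n c' != 0.
Proof.
move=> fK; rewrite -[c]reprK -/(cclass _) Sq_cclass; set z := repr _.
have pz : pullback g z \in @is_cocycle R Y p.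
  rewrite inE cobound_pullback; have /eqP-> := valP z.
  exact/eqP.
move=> /eqP sqz; exists (cclass (Cocycle pz)); rewrite Sq_cclass.
apply/eqP => /cclass_eq0 /= sqgz; apply/sqz/cclass_eq0 => /=.
rewrite sq_pullback in sqgz.
(* By [fK], a singular simplex of [X] pushed along [f] and then [g] returns to itself. *)
suff -> : sq n z = pullback f (pullback g (sq n z)).
  exact: is_coboundary_pullback.
apply/funext => sigma; congr (sq n z _); apply/continuousEP => t /=.
by rewrite fK.
Qed.

(** Pushing forward is functorial, and each fibre of [g \o f] is a single vertex, so all barycentric
    coordinates are kept. *)
Lemma realization_mapK (R : realType) (V W : finType) (K : scomplex V)
    (L : scomplex W) (f : V -> W) (g : W -> V) (Kf : simplicial K L f)
    (Lg : simplicial L K g) : cancel f g ->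
  cancel (realization_map (R := R) Kf) (realization_map (R := R) Lg).
Proof.
move=> fK x; apply: val_inj; rewrite /= push_comp; apply/funext => v.
by rewrite /push (big_pred1 v) // => u /=; rewrite fK.
Qed.

Section Substitution.
Variables (V : finType) (W : V -> finType).
Variables (K : scomplex V) (L : forall i, scomplex (W i)).

Lemma simplicial_subst_section (w : forall i, W i) :
  (forall i, L i [set w i]%SET) ->
  simplicial K (substitution K L) (fun i => Tagged W (w i)).
Proof.
move=> Lw S KS; exists S, (fun i => [set w i]%SET); split=> //.
apply/setP => t; apply/imsetP/bigcupP => -[i iS].
  by move=> ->; exists i; rewrite // imset_set1 inE.
by rewrite imset_set1 inE => /eqP; exists i.
Qed.

Lemma simplicial_subst_tag : simplicial (substitution K L) K tag.
Proof.
(* Some [tau i] may be empty, so the tags form only a subset of [S]. *)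
move=> _ [S [tau [KS _ ->]]]; apply: faceS KS.
apply/fintype.subsetP => _ /imsetP[_ /bigcupP[i iS /imsetP[j _ ->]] ->].
exact: iS.
Qed.

End Substitution.

Theorem proposition6p3p1 (R : realType) (m : nat) (K : scomplex 'I_m)
    (d : 'I_m -> nat) (L : forall i : 'I_m, scomplex 'I_(d i))
    (L_vertex : forall i : 'I_m, exists j : 'I_(d i), L i (finset.set1 j))
    (n : nat) (n_ge1 : (0 < n)%N) :
  nontrivial_Sq R K n ->
  nontrivial_Sq R (substitution K L) n.
Proof.
move=> [p [c Sqc]]; exists p.
(* [cid] turns the existence of vertices into a choice of one in each [L i]. *)
pose Kf := simplicial_subst_section (K := K) (fun i => svalP (cid (L_vertex i))).
pose Lg := @simplicial_subst_tag _ _ K L.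
have fK := realization_mapK (R := R) Kf Lg (fun=> erefl).
exact: (retract_Sq_neq0 (f := realization_map Kf) (g := realization_map Lg) fK Sqc).
Qed.
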